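(* Every quasimodular form (for $\mathrm{SL}_2(\mathbb{Z})$, possibly of mixed weight) is a finite linear combination, with complex coefficients, of the constant function $1$ and the symmetrized MacMahonesque series $\mathcal{U}^{\mathrm{sym}}_{\vec a}(q)$, where $\vec a$ ranges over vectors of odd positive integers of arbitrary positive length.
   Context: Set $q=e^{2\pi i\tau}$ with $\tau$ in the upper half plane. For even $k\geq 2$ let $$G_k(\tau):=-\frac{B_k}{2k}+\sum_{n\geq 1}\sigma_{k-1}(n)q^n,\qquad \sigma_{k-1}(n)=\sum_{d\mid n}d^{k-1},$$ with $B_k$ the Bernoulli numbers. The algebra of quasimodular forms is $\widetilde M=\mathbb{C}[G_2,G_4,G_6]$. For an integer $a\geq1$ and a vector $\vec a=(v_1,\dots,v_a)$ of non-negative integers, define $$M_{\vec a}(n):=\sum_{\substack{0<s_1<\cdots<s_a\\ m_1,\dots,m_a>0\\ n=m_1s_1+\cdots+m_as_a}} m_1^{v_1}\cdots m_a^{v_a},\qquad \mathcal{U}_{\vec a}(q):=\sum_{n\geq 1}M_{\vec a}(n)q^n,$$ where the $s_i$ and $m_i$ are integers. For $\vec a$ with all entries odd define $$\mathcal{U}^{\mathrm{sym}}_{\vec a}(q):=\sum_{\sigma\in S_a}\mathcal{U}_{\sigma\vec a}(q),\qquad \sigma\vec a:=(v_{\sigma(1)},\dots,v_{\sigma(a)}),$$ where $S_a$ is the symmetric group on $a$ letters. *)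

(* Defs.v *)
From HB Require Import structures.
From mathcomp Require Import all_boot all_order all_algebra all_fingroup.
From mathcomp Require Import all_classical all_reals all_analysis.
From mathcomp Require Import complex.
(* [mpoly] is not imported: its notations clash with those of analysis. *)
From mathcomp Require mpoly.

Set Implicit Arguments.
Unset Strict Implicit.
Unset Printing Implicit Defensive.

Import Order.TTheory GRing.Theory Num.Theory.
Import numFieldNormedType.Exports.

Local Open Scope ring_scope.
Local Open Scope complex_scope.

(* The list of B_0, ..., B_(n-1). *)
Fixpoint bernoulli_seq (n : nat) : seq rat :=
  if n is m.+1 then
    let s := bernoulli_seq m in
    rcons s ((m == 0%N)%:R
             - m.+1%:R^-1 * \sum_(k < m) 'C(m.+1, k)%:R * s`_k)
  else [::].

Definition bernoulli_number (n : nat) : rat := (bernoulli_seq n.+1)`_n.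

Lemma bernoulli_number_rec (n : nat) :
  \sum_(k < n.+1) 'C(n.+1, k)%:R * bernoulli_number k = (n == 0%N)%:R.
Proof.
have sz m : size (bernoulli_seq m) = m.
  by elim: m => //= m IH; rewrite size_rcons IH.
have nthb m k : (k < m)%N -> (bernoulli_seq m)`_k = bernoulli_number k.
  elim: m => // m IH; rewrite ltnS leq_eqVlt => /orP[/eqP->//|km].
  by rewrite /= nth_rcons sz km IH.
rewrite big_ord_recr /= {2}/bernoulli_number /= nth_rcons sz ltnn eqxx.
rewrite binSn mulrBr mulrA mulfV ?pnatr_eq0// mul1r.
under [X in _ + (_ - X)]eq_bigr => i _ do rewrite nthb //.
by rewrite addrC subrK; case: n => [|n] /=; rewrite ?mulr1 ?mulr0.
Qed.

Definition divisor_sigma (e n : nat) : nat :=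
  (\sum_(d <- divisors n) d ^ e)%N.

Definition upper_half_plane (R : realType) : Type :=
  {tau : R[i] | 0 < complex.Im tau}.

Definition expC (R : realType) (z : R[i]) : R[i] :=
  (expR (complex.Re z))%:C
  * (cos (complex.Im z) +i* sin (complex.Im z))%C.

Definition nome (R : realType) (tau : upper_half_plane R) : R[i] :=
  expC (2 * (pi : R)%:C * 'i%C * sval tau).

(* The regular module R[i]^o carries the topology of the complex modulus. *)
Definition qseries (R : realType) (c : nat -> nat) (q : R[i]) : R[i] :=
  limn (fun N : nat => \sum_(1 <= n < N) (c n)%:R * q ^+ n : R[i]^o).

(* G_k, meaningful for even k >= 2. *)
Definition eisenstein (R : realType) (k : nat) (tau : upper_half_plane R)
  : R[i] :=
  - (ratr (bernoulli_number k) / (2 * k)%:R)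
  + qseries (divisor_sigma k.-1) (nome tau).

Definition quasimodular (R : realType) (f : upper_half_plane R -> R[i]) : Prop :=
  exists P : mpoly.mpoly 3 R[i], forall tau,
    f tau = mpoly.meval
      (tnth [tuple eisenstein 2 tau; eisenstein 4 tau; eisenstein 6 tau]) P.

(* The equation n = \sum_i m_i s_i with all m_i, s_i > 0 forces
   m_i, s_i <= n, so nothing is lost by letting them range over 'I_n.+1. *)
Definition macmahonesque_coef (a : nat) (v : a.-tuple nat) (n : nat) : nat :=
  (\sum_(s : {ffun 'I_a -> 'I_n.+1} |
           [forall i, 0 < s i]
           && [forall i : 'I_a, forall j : 'I_a, (i < j) ==> (s i < s j)])
   \sum_(m : {ffun 'I_a -> 'I_n.+1} |
           [forall i, 0 < m i] && (n == \sum_(i < a) m i * s i))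
     \prod_(i < a) m i ^ tnth v i)%N.

Definition macmahonesque (R : realType) (a : nat) (v : a.-tuple nat)
  (q : R[i]) : R[i] :=
  qseries (macmahonesque_coef v) q.

Definition macmahonesque_sym (R : realType) (a : nat) (v : a.-tuple nat)
  (q : R[i]) : R[i] :=
  \sum_(sigma : 'S_a) macmahonesque [tuple tnth v (sigma i) | i < a] q.

(* Main.v *)
Require Import Defs.
From mathcomp Require Import all_boot all_order all_algebra all_fingroup.
From mathcomp Require Import all_classical all_reals all_analysis complex.
From mathcomp Require Import zify ring.
From mathcomp Require mpoly.
Import Order.TTheory GRing.Theory Num.Theory.
Import numFieldNormedType.Exports.

Set Implicit Arguments.
Unset Strict Implicit.
Unset Printing Implicit Defensive.

Local Open Scope ring_scope.
Local Open Scope complex_scope.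

(** Put [phi_k(x) = \sum_(m >= 1) m ^ k * x ^ m]. Summing over all orderings of
    the [v_i] turns the increasing tuples [s] of the MacMahonesque series into
    arbitrary tuples of distinct entries, so the symmetrized series attached to
    [v] is the sum over injective [s] of [\prod_i phi_(v_i)(q ^ s_i)]
    ([sum_macmahonesque_coef], [sum_increasing_perm]). In particular the series
    of length one with exponent [k - 1] is the Eisenstein series [G_k] without
    its constant term.

    Hence it suffices that the span of [1] and of the symmetrized series with
    odd entries is stable under multiplication by the series of a single odd
    exponent [k]. In such a product the new index [s] either differs from all
    the [s_i], which gives the series of [k, v_1, ..., v_a], or it equals
    exactly one [s_i], which replaces the factor [phi_(v_i)] by
    [phi_k * phi_(v_i)] ([injsum_mul]). What makes this work is that, for odd
    [k] and [l], the product [phi_k * phi_l] is again a linear combination of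
    [phi_j] with [j] odd: the coefficient
    [\sum_(0 < m < N) m ^ k * (N - m) ^ l] is an odd polynomial in [N]
    ([odd_polynomial_convolution]). Indeed the odd polynomials are spanned by
    the binomials ['C(N + n, 2 * n + 1)], the coefficients of
    [(x / (1 - x) ^ 2) ^ n.+1], and convolution adds such exponents.

    The identity is first proved on coefficients ([sym_coef_mul]), by
    computing with polynomials up to a fixed degree. It passes to the values of
    the series because all the coefficients grow polynomially, so that the
    series converge absolutely in the unit disc, where Cauchy products are
    legitimate ([qseries_convolution]). *)

(** * Convolutions of odd powers *)

(** Both sides count the [p + q + 1]-element subsets of [N + 1] points,
    sorted by the position of their element of rank [p], counted from [0]. *)
Lemma bin_convolution (N p q : nat) :
  (\sum_(m < N.+1) 'C(m, p) * 'C(N - m, q) = 'C(N.+1, (p + q).+1))%N.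
Proof.
elim: N p q => [|N IH] p q.
  rewrite big_ord_recl big_ord0 /= addn0 subn0 !bin0n.
  by case: p => [|p]; case: q => [|q]; rewrite ?binS ?bin0n.
rewrite big_ord_recr /= subnn bin0n.
case: q => [|q] /=.
  rewrite muln1 addn0 [RHS]binS; congr (_ + _)%N.
  by rewrite -[p in RHS]addn0 -IH; apply: eq_bigr => m _; rewrite !bin0.
rewrite muln0 addn0 addnS [RHS]binS -{1}addnS -!IH -big_split /=.
apply: eq_bigr => m _; rewrite subSn ?binS ?mulnDr //.
by rewrite -ltnS.
Qed.

(** As a function of [N] this is an odd polynomial of degree [2 * n + 1]: the
    product of [N - i] for [-n <= i <= n], divided by [(2 * n + 1)!]. *)
Definition odd_binomial (n N : nat) : nat := 'C(N + n, n.*2.+1).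

(** Passing from [n] to [n + 1] multiplies the binomial by
    [N ^ 2 - (n + 1) ^ 2] up to a constant. Read in the two directions, this
    recursion shows that the binomials and the odd powers of [N] span the same
    space. *)
Lemma sqr_odd_binomial (n N : nat) :
  (N ^ 2 * odd_binomial n N =
   n.+1 ^ 2 * odd_binomial n N
   + n.*2.+2 * n.*2.+3 * odd_binomial n.+1 N)%N.
Proof.
rewrite /odd_binomial doubleS addnS.
have := mul_bin_diag (N + n).+1 n.*2.+2; rewrite /=.
have := mul_bin_left (N + n) n.*2.+1.
case: (leqP N n) => [le | lt]; first by rewrite !(@bin_small _ _) //; lia.
have [k ->] : exists k, N = (n.+1 + k)%N by exists (N - n.+1)%N; lia.
set x := 'C(_, n.*2.+1); set y := 'C(_, n.*2.+2); set z := 'C(_, n.*2.+3).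
have -> : (n.+1 + k + n - n.*2.+1 = k)%N by lia.
move=> e1 e2.
by rewrite -mulnA -e2 mulnCA e1; lia.
Qed.

(** Oddness is encoded by the factorization of an odd polynomial as [N] times
    a polynomial in [N ^ 2], which needs no condition on coefficients. *)
Definition odd_polynomial (F : numFieldType) (g : nat -> F) : Prop :=
  exists q : {poly F}, forall N, g N = N%:R * q.[N%:R ^+ 2].

Lemma odd_polynomial_sum (F : numFieldType) (I : finType) (c : I -> F)
    (g : I -> nat -> F) :
  (forall i, odd_polynomial (g i)) ->
  odd_polynomial (fun N => \sum_i c i * g i N).
Proof.
move=> /fin_all_exists[q qE]; exists (\sum_i c i *: q i) => N.
rewrite horner_sum mulr_sumr; apply: eq_bigr => i _.
by rewrite qE hornerZ mulrCA.
Qed.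

Lemma odd_polynomial_coef (F : numFieldType) (g : nat -> F) :
  odd_polynomial g ->
  exists (d : nat) (c : nat -> F),
    forall N, g N = \sum_(j < d) c j * (N ^ j.*2.+1)%:R.
Proof.
case=> q qE; exists (size q), (fun j => q`_j) => N.
rewrite qE horner_coef mulr_sumr; apply: eq_bigr => j _.
by rewrite -[j.*2]mul2n expnS expnM natrM natrX natrX mulrCA.
Qed.

Lemma odd_polynomial_binomial (F : numFieldType) (n : nat) :
  @odd_polynomial F (fun N => (odd_binomial n N)%:R).
Proof.
elim: n => [|n [q qE]].
  by exists 1 => N; rewrite hornerC mulr1 /odd_binomial addn0 bin1.
exists ((n.*2.+2 * n.*2.+3)%:R^-1 *: (('X - (n.+1 ^ 2)%:R%:P) * q)) => N.
have nz : (n.*2.+2 * n.*2.+3)%:R != 0 :> F by rewrite pnatr_eq0.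
apply: (mulfI nz); rewrite hornerZ hornerM hornerXsubC mulrCA.
rewrite mulVKf // mulrCA -qE mulrBl -natrX -!natrM.
by rewrite sqr_odd_binomial natrD addrAC subrr add0r.
Qed.

Lemma odd_power_binomial (F : numFieldType) (a : nat) :
  exists c : nat -> F, forall N,
    (N ^ a.*2.+1)%:R = \sum_(n < a.+1) c n * (odd_binomial n N)%:R.
Proof.
elim: a => [|a [c cE]].
  exists (fun=> 1) => N.
  by rewrite big_ord1 mul1r /odd_binomial addn0 bin1 expn1.
pose c' n := if (n <= a)%N then c n * (n.+1 ^ 2)%:R else 0.
pose c'' n := if n is n'.+1 then c n' * (n'.*2.+2 * n'.*2.+3)%:R else 0.
exists (fun n => c' n + c'' n) => N.
under eq_bigr => n _ do rewrite mulrDl.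
rewrite big_split /= [X in X + _]big_ord_recr [X in _ + X]big_ord_recl /=.
have -> : c' a.+1 = 0 by rewrite /c' ltnn.
rewrite !mul0r addr0 add0r -big_split /=.
rewrite doubleS expnS expnS mulnA mulnn natrM cE mulr_sumr.
apply: eq_bigr => n _.
rewrite /c' -ltnS ltn_ord mulrCA -natrM sqr_odd_binomial natrD mulrDr !natrM.
by rewrite !mulrA.
Qed.

(** Expanding both powers in the binomials reduces the claim to the convolution
    of two binomials, which is a single binomial. *)
Lemma odd_polynomial_convolution (F : numFieldType) (a b : nat) :
  @odd_polynomial F (fun N =>
    \sum_(m < N.+1) (m ^ a.*2.+1 * (N - m) ^ b.*2.+1)%:R).
Proof.
have [c cE] := odd_power_binomial F a; have [d dE] 
  := odd_power_binomial F b.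
have conv i j N : (\sum_(m < N.+1) odd_binomial i m * odd_binomial j (N - m)
    = odd_binomial (i + j).+1 N)%N.
  rewrite /odd_binomial.
  have := bin_convolution (i + N + j) i.*2.+1 j.*2.+1.
  have -> : ((i + N + j).+1 = N + (i + j).+1)%N by lia.
  have -> : (i.*2.+1 + j.*2.+1).+1 = (i + j).+1.*2.+1 by lia.
  move=> <-.
  (* Only the window i <= m <= i + N contributes. *)
  rewrite -(big_mkord xpredT (fun m =>
    'C(m, i.*2.+1) * 'C(i + N + j - m, j.*2.+1)))%N; apply/esym.
  rewrite (@big_cat_nat _ _ _ i) //=; last by lia.
  rewrite big_nat_cond [X in (X + _)%N]big1 ?add0n; last first.
    by move=> m /andP[/andP[_ mi] _]; rewrite bin_small //; lia.
  rewrite (@big_cat_nat _ _ _ (N.+1 + i)) //=; try lia.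
  rewrite [X in (_ + X)%N]big_nat_cond [X in (_ + X)%N]big1 ?addn0;
    last first.
    by move=> m /andP[/andP[mi _] _]; rewrite [X in (_ * X)%N]bin_small; lia.
  rewrite -{1}[i : nat]add0n big_addn addnK big_mkord.
  apply: eq_bigr => m _; congr (_ * 'C(_, _))%N.
  by have := ltn_ord m; lia.
have := @odd_polynomial_sum F ('I_a.+1 * 'I_b.+1)%type
  (fun ij => c ij.1 * d ij.2)
  (fun ij N => (odd_binomial (ij.1 + ij.2).+1 N)%:R)
  (fun ij => odd_polynomial_binomial F _).
case=> q qE; exists q => N; rewrite -qE.
rewrite -(pair_bigA _ (fun (i : 'I_a.+1) (j : 'I_b.+1) =>
  c i * d j * (odd_binomial (i + j).+1 N)%:R)) /=.
under eq_bigr => m _ do rewrite natrM cE dE big_distrlr /=.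
rewrite exchange_big; apply: eq_bigr => i _ /=.
rewrite exchange_big; apply: eq_bigr => j _ /=.
rewrite -conv natr_sum mulr_sumr; apply: eq_bigr => m _.
by rewrite natrM mulrACA.
Qed.

(** * Sums over injective tuples *)

Definition fcons (T : Type) (a : nat) (x : T) (v : 'I_a -> T)
    (i : 'I_a.+1) : T :=
  oapp v x (unlift ord0 i).

Definition replace_at (T : Type) (a : nat) (i : 'I_a) (x : T) (v : 'I_a -> T)
    (j : 'I_a) : T :=
  if j == i then x else v j.

Lemma fcons0 (T : Type) (a : nat) (x : T) (v : 'I_a -> T) : fcons x v ord0 = x.
Proof. by rewrite /fcons unlift_none. Qed.

Lemma fconsS (T : Type) (a : nat) (x : T) (v : 'I_a -> T) (i : 'I_a) :
  fcons x v (lift ord0 i) = v i.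
Proof. by rewrite /fcons liftK. Qed.

Lemma fcons_injectiveb (S : finType) (a : nat) (x : S) (s : 'I_a -> S) :
  injectiveb (fcons x s) = (x \notin codom s) && injectiveb s.
Proof.
apply/injectiveP/andP => [inj | [xs /injectiveP inj] i j].
  split; last first.
    apply/injectiveP => i j e; apply: (@lift_inj _ ord0); apply: inj.
    by rewrite !fconsS.
  apply/negP => /codomP[i xi]; have: fcons x s (lift ord0 i) = fcons x s ord0.
    by rewrite fconsS fcons0 -xi.
  by move/inj.
case: (unliftP ord0 i) => [i'|] ->; case: (unliftP ord0 j) => [j'|] ->;
  rewrite ?fcons0 ?fconsS //.
- by move=> /inj ->.
- by move=> e; rewrite -e codom_f in xs.
- by move=> e; rewrite e codom_f in xs.
Qed.

Definition injsum (A : comPzRingType) (S : finType) (a : nat)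
    (g : 'I_a -> S -> A) : A :=
  \sum_(s : {ffun 'I_a -> S} | injectiveb s) \prod_i g i (s i).

Lemma eq_injsum (A : comPzRingType) (S : finType) (a : nat)
    (g g' : 'I_a -> S -> A) : (forall i x, g i x = g' i x) ->
  injsum g = injsum g'.
Proof.
by move=> e; apply: eq_bigr => s _; apply: eq_bigr => i _; rewrite e.
Qed.

(** Multiplying by one more sum: the new point [x] either avoids the values of
    the injective tuple [s], and extends it, or it is the value of [s] at
    exactly one index [i], whose factor then absorbs [h]. *)
Lemma injsum_mul (A : comPzRingType) (S : finType) (a : nat)
    (h : S -> A) (g : 'I_a -> S -> A) :
  (\sum_x h x) * injsum g =
  injsum (fcons h g)
  + \sum_i injsum (replace_at i (fun x => h x * g i x) g).
Proof.
pose cons (p : {ffun 'I_a -> S} * S) := [ffun i => fcons p.2 p.1 i].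
pose uncons (s : {ffun 'I_a.+1 -> S}) := ([ffun j => s (lift ord0 j)], s ord0).
have consK : cancel cons uncons.
  move=> [s x]; rewrite /uncons /cons ffunE fcons0; congr pair.
  by apply/ffunP => i; rewrite !ffunE fconsS.
have unconsK : cancel uncons cons.
  move=> s; apply/ffunP => i; rewrite ffunE /=.
  by case: (unliftP ord0 i) => [j|] ->; rewrite ?fcons0 ?fconsS ?ffunE.
rewrite {2}/injsum (reindex cons) /=; last first.
  by exists uncons => ? _; rewrite ?consK ?unconsK.
rewrite (eq_bigl (fun p : {ffun 'I_a -> S} * S =>
    injectiveb p.1 && (p.2 \notin codom p.1))); last first.
  move=> p; rewrite andbC -fcons_injectiveb /injectiveb /dinjectiveb.
  by congr uniq; apply: eq_map => i; rewrite ffunE.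
rewrite (eq_bigr (fun p : {ffun 'I_a -> S} * S =>
    h p.2 * \prod_i g i (p.1 i))); last first.
  move=> [s x] _; rewrite big_ord_recl ffunE !fcons0; congr (_ * _).
  by apply: eq_bigr => i _; rewrite ffunE !fconsS.
rewrite -(pair_big_dep (fun s : {ffun 'I_a -> S} => injectiveb s)
  (fun (s : {ffun 'I_a -> S}) x => x \notin codom s)
  (fun (s : {ffun 'I_a -> S}) x => h x * \prod_i g i (s i))) /=.
rewrite [X in _ + X]exchange_big -big_split mulr_sumr /=.
apply: eq_bigr => s sinj.
rewrite mulr_suml (bigID (fun x => x \in codom s)) /= addrC; congr (_ + _).
rewrite (eq_bigl (mem (s @: 'I_a))); last first.
  by move=> x; apply/codomP/imsetP => [[i ->]|[i _ ->]]; exists i.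
rewrite big_imset /=; last by move=> i j _ _; apply: (injectiveP _ sinj).
apply: eq_bigr => i _; rewrite [RHS](bigD1 i) //= (bigD1 i) //=.
rewrite /replace_at eqxx mulrA; congr (_ * _).
by apply: eq_bigr => j /negPf->.
Qed.

Lemma injsum1 (A : comPzRingType) (S : finType) (h : S -> A) :
  injsum (fun _ : 'I_1 => h) = \sum_x h x.
Proof.
pose g : 'I_0 -> S -> A := fun=> h.
have g1 : injsum g = 1.
  rewrite /injsum (eq_bigl xpredT) => [|s]; last first.
    by apply/injectiveP => i; case: i.
  rewrite (eq_bigr (fun=> 1)) => [|s _]; last by rewrite big_ord0.
  by rewrite sumr_const card_ffun card_ord expn0.
have := injsum_mul h g; rewrite g1 mulr1 big_ord0 addr0 => ->.
by apply: eq_injsum => i x; rewrite /fcons; case: unlift.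
Qed.

(** * Coefficients of the symmetrized series *)

(** The coefficient of [q ^ n] in the symmetrized series, with the entries of
    [s] and [m] at most [B]. Any [B >= n] gives the same number, and the freedom
    in [B] allows all the coefficients of a product to be read off polynomials
    with one common bound. *)
Definition bounded_sym_coef (B a : nat) (v : 'I_a -> nat) (n : nat) : nat :=
  (\sum_(s : {ffun 'I_a -> 'I_B.+1} | [forall i, 0 < s i] && injectiveb s)
   \sum_(m : {ffun 'I_a -> 'I_B.+1} |
           [forall i, 0 < m i] && (n == \sum_(i < a) m i * s i))
     \prod_(i < a) m i ^ v i)%N.

(** The part of degree at most [B] in the variable [X ^ s] of
    [\sum_(m >= 1) m ^ k X ^ (m * s)]. It is set to [0] at [s = 0], so that
    a sum over all [s] in ['I_B.+1] is a sum over the positive ones; likewise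
    the term [m = 0] vanishes when [k > 0]. *)
Definition power_poly (F : numFieldType) (B k s : nat) : {poly F} :=
  if (0 < s)%N then (\poly_(m < B.+1) (m ^ k)%:R) \Po 'X^s else 0.

Definition sym_poly (F : numFieldType) (B a : nat) (v : 'I_a -> nat) :
    {poly F} :=
  injsum (fun i (s : 'I_B.+1) => power_poly F B (v i) s).

Lemma power_polyE (F : numFieldType) (B k s : nat) : (0 < s)%N ->
  power_poly F B k s = \sum_(m < B.+1) (m ^ k)%:R *: 'X^(m * s).
Proof.
move=> s0; rewrite /power_poly s0 poly_def raddf_sum /=.
by apply: eq_bigr => m _; rewrite comp_polyZ comp_Xn_poly -exprM mulnC.
Qed.

Lemma coef_sym_poly (F : numFieldType) (B a : nat) (v : 'I_a -> nat)
    (n : nat) : (forall i, 0 < v i)%N ->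
  (sym_poly F B v)`_n = (bounded_sym_coef B v n)%:R.
Proof.
move=> v0; rewrite coef_sum /bounded_sym_coef big_mkcondl /= natr_sum.
apply: eq_bigr => s sinj.
case: ifP => [/forallP s0 | /negbT]; last first.
  rewrite negb_forall => /existsP[ i ]; rewrite -eqn0Ngt => /eqP si0.
  by rewrite (bigD1 i) //= /power_poly si0 mul0r coef0.
rewrite (eq_bigr (fun i =>
    \sum_(m < B.+1) (m ^ v i)%:R *: 'X^(m * s i))); last first.
  by move=> i _; rewrite power_polyE.
rewrite bigA_distr_bigA coef_sum natr_sum [RHS]big_mkcond /=.
apply: eq_bigr => m _.
rewrite scaler_prod prodrXr coefZ coefXn -natr_prod.
case: (boolP [forall i, 0 < m i]%N) => [_ | ]; rewrite /= ?negb_forall.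
  by case: eqP; rewrite ?mulr1 ?mulr0.
move=> /existsP[ i ]; rewrite -eqn0Ngt => /eqP mi0.
by rewrite (bigD1 i) //= mi0 exp0n // !mul0n mul0r.
Qed.

(** The frame for changing the bound on [s] and on [m]: a summand that
    vanishes as soon as some entry exceeds [n] does not depend on a bound above
    [n]. *)
Lemma sum_ffun_widen (a n B : nat) (F : ('I_a -> nat) -> nat) : (n <= B)%N ->
  (forall f i, (n < f i)%N -> F f = 0%N) ->
  (\sum_(s : {ffun 'I_a -> 'I_B.+1}) F (fun i => s i) =
   \sum_(s : {ffun 'I_a -> 'I_n.+1}) F (fun i => s i))%N.
Proof.
move=> nB F0.
pose w (s : {ffun 'I_a -> 'I_n.+1}) : {ffun 'I_a -> 'I_B.+1} :=
  [ffun i => widen_ord (nB : n < B.+1)%N (s i)].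
pose u (s : {ffun 'I_a -> 'I_B.+1}) : {ffun 'I_a -> 'I_n.+1} :=
  [ffun i => inord (s i)].
rewrite (bigID (fun s : {ffun 'I_a -> 'I_B.+1} => [forall i, s i <= n]%N)) /=.
rewrite [X in (_ + X)%N]big1 => [|s]; last first.
  by rewrite negb_forall => /existsP[ i ]; rewrite -ltnNge => nsi;
    apply: (F0 _ i).
rewrite addn0 (reindex_onto w u) /= => [|s /forallP sn]; last first.
  by apply/ffunP => i; apply: val_inj; rewrite !ffunE /= inordK ?ltnS.
apply: eq_big => [s|s _].
  apply/andP; split.
    by apply/forallP => i; rewrite ffunE /= -ltnS.
  by apply/eqP/ffunP => i; apply: val_inj; rewrite !ffunE /= inordK.
by congr F; apply: boolp.funext => i; rewrite ffunE.
Qed.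

(** In a decomposition [n = \sum_i m_i * s_i] into positive numbers no [m_i] and
    no [s_i] exceeds [n]. *)
Lemma bounded_sym_coefE (B a : nat) (v : 'I_a -> nat) (n : nat) : (n <= B)%N ->
  bounded_sym_coef B v n = bounded_sym_coef n v n.
Proof.
move=> nB.
pose G (C : nat) (f : 'I_a -> nat) :=
  (if [forall i, 0 < f i]%N && injectiveb f then
   \sum_(m : {ffun 'I_a -> 'I_C.+1})
     if [forall i, 0 < m i] && (n == \sum_(i < a) m i * f i)
     then \prod_(i < a) m i ^ v i else 0 else 0)%N.
have symE C : bounded_sym_coef C v n =
    (\sum_(s : {ffun 'I_a -> 'I_C.+1}) G C (fun i => s i))%N.
  rewrite /bounded_sym_coef big_mkcond; apply: eq_bigr => s _; rewrite /G.
  rewrite -big_mkcond /=.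
  congr (if _ && _ then _ else _).
  apply/injectiveP/injectiveP => inj i j e; apply: inj => /=.
    exact: val_inj.
  by rewrite e.
have GB f : G B f = G n f.
  rewrite /G; case: ifP => // /andP[/forallP f0 _].
  apply: (sum_ffun_widen (F := fun m => if [forall i, 0 < m i]%N
    && (n == \sum_(i < a) m i * f i)%N then (\prod_(i < a) m i ^ v i)%N
    else 0%N)) => // m j nm; case: ifP => // /andP[_ /eqP ne].
  suff: (m j <= n)%N by rewrite leqNgt nm.
  by rewrite ne (bigD1 j) //= (leq_trans _ (leq_addr _ _)) ?leq_pmulr.
rewrite !symE -(@sum_ffun_widen _ n B (G n)) //.
  by apply: eq_bigr => s _; rewrite GB.
move=> f i nf; rewrite /G; case: ifP => // _.
apply: big1 => m _; case: ifP => // /andP[/forallP m0 /eqP ne].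
suff: (f i <= n)%N by rewrite leqNgt nf.
by rewrite ne (bigD1 i) //= (leq_trans _ (leq_addr _ _)) ?leq_pmull.
Qed.

(** * The product rule on coefficients *)

(** In degree at most [B], the truncated series multiply like the full ones, and
    substituting [X ^ s] for [X] preserves relations between them. *)
Lemma coef_power_polyM (F : numFieldType) (k l d : nat) (c : nat -> F) :
  (forall N, \sum_(m < N.+1) (m ^ k * (N - m) ^ l)%:R =
    \sum_(j < d) c j * (N ^ j.*2.+1)%:R) ->
  forall B s t, (t <= B)%N ->
  (power_poly F B k s * power_poly F B l s)`_t =
  (\sum_(j < d) c j *: power_poly F B j.*2.+1 s)`_t.
Proof.
move=> cE B s t tB; rewrite /power_poly.
case: ifP => s0; last first.
  by rewrite mul0r big1 // => j _; rewrite scaler0.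
under [in RHS]eq_bigr => j _ do rewrite -comp_polyZ.
rewrite -raddf_sum /= -comp_polyM !coef_comp_poly_Xn //.
case: ifP => // st.
have tsB : (t %/ s < B.+1)%N by rewrite ltnS (leq_trans (leq_div _ _)).
rewrite coefM coef_sum.
under [RHS]eq_bigr => j _ do rewrite coefZ coef_poly tsB.
rewrite -cE; apply: eq_bigr => m _; rewrite !coef_poly natrM.
by rewrite (leq_trans (ltn_ord m)) // (leq_ltn_trans (leq_subr _ _)).
Qed.

Lemma injsum_replace_at (A : comPzRingType) (S : finType) (a : nat) (i : 'I_a)
    (h : S -> A) (g : 'I_a -> S -> A) :
  injsum (replace_at i h g) =
  \sum_(s : {ffun 'I_a -> S} | injectiveb s)
    h (s i) * \prod_(j < a | j != i) g j (s j).
Proof.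
apply: eq_bigr => s _; rewrite (bigD1 i) //= /replace_at eqxx; congr (_ * _).
by apply: eq_bigr => j /negPf->.
Qed.

Definition sym_coef (a : nat) (v : 'I_a -> nat) (n : nat) : nat :=
  bounded_sym_coef n v n.

(** The product of the series of length one with exponent [k] and of the series
    of [v], on coefficients. *)
Lemma sym_coef_mul (F : numFieldType) (a k : nat) (v : 'I_a -> nat) :
  odd k -> (forall i, odd (v i)) ->
  exists (d : 'I_a -> nat) (c : 'I_a -> nat -> F), forall n,
    \sum_(j < n.+1) (sym_coef (fun _ : 'I_1 => k) j)%:R
      * (sym_coef v (n - j))%:R =
    (sym_coef (fcons k v) n)%:R
    + \sum_(i < a) \sum_(j < d i)
        c i j * (sym_coef (replace_at i j.*2.+1 v) n)%:R.
Proof.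
move=> ko vo.
have /fin_all_exists[d /fin_all_exists[c cE]] (i : 'I_a) :
    exists (d : nat) (c : nat -> F), forall N,
    \sum_(m < N.+1) (m ^ k * (N - m) ^ v i)%:R =
    \sum_(j < d) c j * (N ^ j.*2.+1)%:R.
  rewrite -(odd_double_half k) -(odd_double_half (v i)) ko vo.
  exact: (odd_polynomial_coef (odd_polynomial_convolution F _ _)).
exists d, c => n.
transitivity ((sym_poly F n (fun _ : 'I_1 => k) * sym_poly F n v)`_n).
  rewrite coefM; apply: eq_bigr => j _.
  rewrite !coef_sym_poly; try by move=> *; apply: odd_gt0.
  by rewrite !bounded_sym_coefE ?leq_subr // -ltnS.
rewrite /sym_poly injsum1 injsum_mul coefD; congr (_ + _).
  rewrite -coef_sym_poly => [|i].
    congr (polyseq _)`_n; apply: eq_injsum => i x.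
    by rewrite /fcons; case: unlift.
  by rewrite /fcons; case: unlift => [j|] /=; apply: odd_gt0.
rewrite coef_sum; apply: eq_bigr => i _.
transitivity ((\sum_(j < d i)
    c i j *: sym_poly F n (replace_at i j.*2.+1 v))`_n); last first.
  rewrite coef_sum; apply: eq_bigr => j _; rewrite coefZ coef_sym_poly // => l.
  by rewrite /replace_at; case: ifP => // _; apply: odd_gt0.
rewrite injsum_replace_at.
have -> : \sum_(j < d i) c i j *: sym_poly F n (replace_at i j.*2.+1 v) =
    \sum_(s : {ffun 'I_a -> 'I_n.+1} | injectiveb s)
      (\sum_(j < d i) c i j *: power_poly F n j.*2.+1 (s i))
      * \prod_(j < a | j != i) power_poly F n (v j) (s j).
  under [RHS]eq_bigr => s _ do rewrite mulr_suml.
  rewrite exchange_big; apply: eq_bigr => j _ /=.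
  under [in RHS]eq_bigr do rewrite -scalerAl.
  rewrite -scaler_sumr; congr (_ *: _).
  rewrite -(injsum_replace_at i (fun x : 'I_n.+1 => power_poly F n j.*2.+1 x)
    (fun l (x : 'I_n.+1) => power_poly F n (v l) x)).
  apply: eq_injsum => l x.
  by rewrite /replace_at; case: eqP.
rewrite !coef_sum; apply: eq_bigr => s _.
rewrite !coefM; apply: eq_bigr => t _; congr (_ * _).
by apply: (coef_power_polyM (cE i)); rewrite -ltnS.
Qed.

(** A representation [n = m * s] is a divisor [m] of [n]. *)
Lemma sym_coef1 (k n : nat) : (0 < k)%N -> (0 < n)%N ->
  sym_coef (fun _ : 'I_1 => k) n = divisor_sigma k n.
Proof.
move=> k0 n0; apply/eqP; rewrite -(eqr_nat rat); apply/eqP.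
rewrite -coef_sym_poly // /sym_poly injsum1 coef_sum /divisor_sigma.
rewrite (eq_bigr (fun s : 'I_n.+1 =>
    \sum_(m < n.+1) (m ^ k * (n == m * s)%N)%:R)); last first.
  move=> s _; case: (posnP s) => [s0|s0].
    rewrite /power_poly s0 coef0 big1 // => m _.
    by rewrite muln0 gtn_eqF // muln0.
  rewrite power_polyE // coef_sum; apply: eq_bigr => m _.
  by rewrite coefZ coefXn natrM.
rewrite exchange_big natr_sum /=.
have -> : \sum_(d <- divisors n) (d ^ k)%:R =
    \sum_(m < n.+1 | (m %| n)%N) (m ^ k)%:R :> rat.
  rewrite -(big_mkord (fun m => m %| n)%N (fun m => (m ^ k)%:R)) -big_filter.
  apply: perm_big; apply: uniq_perm.
  - exact: divisors_uniq.
  - by rewrite filter_uniq // iota_uniq.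
  - move=> m; rewrite mem_filter -dvdn_divisors // mem_index_iota ltnS /=.
    by case: (boolP (m %| n)%N) => // /dvdn_leq ->.
rewrite [RHS]big_mkcond /=; apply: eq_bigr => m _.
case: ifP => [/dvdnP[s ns]|/negP mN]; last first.
  apply: big1 => s _; case: eqP => [e|]; last by rewrite muln0.
  by case: mN; apply/dvdnP; exists s; rewrite mulnC.
have m0 : (0 < m)%N.
  by rewrite lt0n; apply: contraL n0 => /eqP m0; rewrite ns m0 muln0.
have sN : (s < n.+1)%N by rewrite ltnS ns leq_pmulr.
rewrite (bigD1 (Ordinal sN)) //= [(m * s)%N]mulnC -ns eqxx muln1.
rewrite big1 ?addr0 // => s' ne.
case: eqP => [e|]; last by rewrite muln0.
case/eqP: ne; apply: val_inj => /=; apply/eqP.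
by rewrite -(eqn_pmul2r m0) -ns mulnC -e.
Qed.

(** * Symmetrization *)

Definition increasing (a : nat) (f : 'I_a -> nat) : bool :=
  [forall i : 'I_a, forall j : 'I_a, (i < j)%N ==> (f i < f j)%N].

Lemma increasingE (a : nat) (f : 'I_a -> nat) :
  increasing f = sorted ltn [tuple f i | i < a].
Proof.
rewrite sorted_pairwise; last exact: ltn_trans.
apply/idP/(pairwiseP 0%N) => [/forallP inc i j | inc].
  rewrite !inE size_tuple => ia ja ij.
  rewrite -[ i ]/(nat_of_ord (Ordinal ia)) -[j]/(nat_of_ord (Ordinal ja)).
  by rewrite -!tnth_nth !tnth_mktuple; apply: (implyP (forallP (inc _) _)).
apply/forallP => i; apply/forallP => j; apply/implyP => ij.
have := inc i j; rewrite !inE size_tuple !ltn_ord -!tnth_nth !tnth_mktuple.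
exact.
Qed.

Lemma increasing_inj (a : nat) (f : 'I_a -> nat) : increasing f -> injective f.
Proof.
move=> /forallP inc i j e; apply: val_inj => /=.
have := implyP (forallP (inc i) j); have := implyP (forallP (inc j) i).
by rewrite e ltnn; case: ltngtP => // _ A B; [have := A isT | have := B isT].
Qed.

(** A tuple with distinct entries is sorted by exactly one permutation, and a
    tuple with a repetition by none into a strictly increasing one. *)
Lemma sum_increasing_perm (a : nat) (f : 'I_a -> nat) :
  (\sum_(sigma : 'S_a) increasing (fun i => f (sigma i)) = injectiveb f)%N.
Proof.
case: (boolP (injectiveb f)) => [/injectiveP finj | ninj] /=; last first.
  apply: big1 => sigma _.
  case: (boolP (increasing _)) => // /increasing_inj inj.
  case/injectiveP: ninj => i j e.
  by apply: (@perm_inj _ sigma^-1%g); apply: inj; rewrite !permKV.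
pose t := [tuple f i | i < a].
have /tuple_permP[sigma sE] : perm_eq (sort leq t) t by rewrite perm_sort.
have incs : increasing (fun i => f (sigma i)).
  rewrite increasingE.
  have -> : [tuple f (sigma i) | i < a] = sort leq t :> seq nat.
    by rewrite sE; congr val; apply: eq_mktuple => i; rewrite tnth_mktuple.
  rewrite ltn_sorted_uniq_leq sort_uniq sort_sorted ?andbT;
    last exact: leq_total.
  by rewrite map_inj_uniq ?enum_uniq.
rewrite (bigD1 sigma) //= incs big1 // => tau /eqP ne.
case: (boolP (increasing _)) => // inct; case: ne; apply/permP => i.
apply: finj; rewrite -[LHS](tnth_mktuple (fun i => f (tau i))).
rewrite -[RHS](tnth_mktuple (fun i => f (sigma i))); congr tnth.
apply: val_inj; apply: (irr_sorted_eq ltn_trans ltnn).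
- by rewrite -increasingE.
- by rewrite -increasingE.
move=> x; apply/mapP/mapP => -[j _ ->].
  by exists (sigma^-1%g (tau j)); rewrite ?mem_enum ?permKV.
by exists (tau^-1%g (sigma j)); rewrite ?mem_enum ?permKV.
Qed.

(** Each [sigma] contributes the tuples that it sorts, after [sigma] has been
    moved from [v] to the summation variables [s] and [m]. *)
Lemma sum_macmahonesque_coef (a : nat) (v : a.-tuple nat) (n : nat) :
  (\sum_(sigma : 'S_a)
     macmahonesque_coef [tuple tnth v (sigma i) | i < a] n =
   sym_coef (tnth v) n)%N.
Proof.
pose G (s : {ffun 'I_a -> 'I_n.+1}) := (\sum_(m : {ffun 'I_a -> 'I_n.+1} |
           [forall i, 0 < m i] && (n == \sum_(i < a) m i * s i))
     \prod_(i < a) m i ^ tnth v i)%N.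
pose act (sigma : 'S_a) (s : {ffun 'I_a -> 'I_n.+1}) := [ffun i => s (sigma i)].
have act_inj sigma : injective (act sigma).
  move=> s s' /ffunP e; apply/ffunP => i.
  by have := e (sigma^-1%g i); rewrite !ffunE permKV.
have forall_act sigma s :
    [forall i, 0 < act sigma s i]%N = [forall i, 0 < s i]%N.
  apply/forallP/forallP => s0 i; last by rewrite ffunE.
  by have := s0 (sigma^-1%g i); rewrite ffunE permKV.
transitivity (\sum_(sigma : 'S_a)
    \sum_(s : {ffun 'I_a -> 'I_n.+1} | [forall i, 0 < s i])
      increasing (fun i => s (sigma i)) * G s)%N.
  apply: eq_bigr => sigma _.
  rewrite /macmahonesque_coef (reindex_inj (act_inj sigma)) big_mkcondr /=.
  apply: eq_big => [s|s _]; first by rewrite forall_act.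
  rewrite -/(increasing (fun i => act sigma s i)).
  have -> : increasing (fun i => act sigma s i)
      = increasing (fun i => s (sigma i)).
    by congr increasing; apply: boolp.funext => i; rewrite ffunE.
  case: ifP => _; rewrite ?mul0n // mul1n.
  rewrite (reindex_inj (act_inj sigma)); apply: eq_big => [m|m _].
    rewrite forall_act.
    rewrite [X in _ = _ && (_ == X)](reindex_inj (@perm_inj _ sigma)).
    by congr (_ && (_ == _)); apply: eq_bigr => i _; rewrite !ffunE.
  rewrite [RHS](reindex_inj (@perm_inj _ sigma)).
  by apply: eq_bigr => i _; rewrite ffunE tnth_mktuple.
rewrite exchange_big /sym_coef /bounded_sym_coef [RHS]big_mkcondr /=.
apply: eq_bigr => s _.
rewrite -big_distrl /= (sum_increasing_perm (fun i => s i)).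
have -> : injectiveb (fun i => nat_of_ord (s i)) = injectiveb s.
  apply/injectiveP/injectiveP => inj i j e; apply: inj => /=.
    by rewrite e.
  exact: val_inj.
by case: ifP => _; rewrite ?mul1n ?mul0n.
Qed.

(** * Power series with tame coefficients *)

Definition convolution (c d : nat -> nat) (n : nat) : nat :=
  (\sum_(j < n.+1) c j * d (n - j))%N.

(** The first [N] coefficients of a Cauchy product, as the lower left triangle
    of the square of all pairs of terms. *)
Lemma sum_triangle (V : nmodType) (F : nat -> nat -> V) (N : nat) :
  \sum_(n < N) \sum_(j < n.+1) F j (n - j)%N =
  \sum_(i < N) \sum_(j < N | (i + j < N)%N) F i j.
Proof.
under eq_bigr => n _.
  rewrite (big_ord_widen_cond _ xpredT (fun j => F j (n - j)%N) (ltn_ord n)).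
  over.
rewrite (exchange_big_dep xpredT) //=; apply: eq_bigr => i _.
rewrite -(big_mkord (fun n => (i < n.+1)%N) (fun n => F i (n - i)%N)).
rewrite -(big_mkord (fun j => (i + j < N)%N) (F i)).
rewrite (@big_cat_nat _ _ _ i) //=; last exact: ltnW.
rewrite big_nat_cond big1 ?add0r; last first.
  by move=> n /andP[/andP[_ ni] ii]; move: ni ii; lia.
rewrite -{1}[i : nat]add0n big_addn.
rewrite [RHS](@big_cat_nat _ _ _ (N - i)) ?leq_subr //=.
rewrite [X in _ = _ + X]big_nat_cond [X in _ = _ + X]big1 ?addr0; last first.
  by move=> n /andP[/andP[]]; lia.
rewrite big_nat_cond [RHS]big_nat_cond; apply: eq_big => [n|n _].
  by lia.
by rewrite addnK.
Qed.

Lemma sum_convolution (A : comPzRingType) (c d : nat -> nat) (x : A) (N : nat) :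
  \sum_(n < N) (convolution c d n)%:R * x ^+ n =
  \sum_(i < N) \sum_(j < N | (i + j < N)%N)
    ((c i)%:R * x ^+ i) * ((d j)%:R * x ^+ j).
Proof.
rewrite -(sum_triangle (fun i j => ((c i)%:R * x ^+ i) * ((d j)%:R * x ^+ j))).
apply: eq_bigr => n _; rewrite natr_sum mulr_suml; apply: eq_bigr => j _.
by rewrite mulrACA -exprD natrM subnKC // -ltnS.
Qed.

(** For non-negative coefficients, bounded partial sums at all radii below [1]
    amount to a radius of convergence at least [1]. *)
Definition tame (R : realType) (c : nat -> nat) : Prop :=
  forall r : R, 0 <= r < 1 ->
  exists K : R, forall N, \sum_(n < N) (c n)%:R * r ^+ n <= K.

Lemma tame_le (R : realType) (c d : nat -> nat) :
  (forall n, c n <= d n)%N -> tame R d -> tame R c.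
Proof.
move=> cd td r r01; have [K dK] := td r r01; exists K => N.
apply: le_trans (dK N); apply: ler_sum => n _.
by rewrite ler_wpM2r ?ler_nat ?exprn_ge0 //; case/andP: r01.
Qed.

Lemma partial_ge0 (R : realType) (c : nat -> nat) (r : R) (N : nat) :
  0 <= r -> 0 <= \sum_(n < N) (c n)%:R * r ^+ n.
Proof.
by move=> r0; rewrite sumr_ge0 // => n _; rewrite mulr_ge0 ?exprn_ge0.
Qed.

Lemma tame_convolution (R : realType) (c d : nat -> nat) :
  tame R c -> tame R d -> tame R (convolution c d).
Proof.
move=> tc td r r01; have [[K cK] [L dL]] := (tc r r01, td r r01).
have /andP[r0 _] := r01; exists (K * L) => N; rewrite sum_convolution.
apply: le_trans (ler_pM _ _ (cK N) (dL N)); rewrite ?partial_ge0 //.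
rewrite big_distrlr /=; apply: ler_sum => i _; rewrite big_mkcond.
by apply: ler_sum => j _; case: ifP; rewrite // !mulr_ge0 ?exprn_ge0.
Qed.

Lemma sqrt_lt1 (R : realType) (r : R) : 0 <= r < 1 -> 0 <= Num.sqrt r < 1.
Proof.
by case/andP=> r0 r1; rewrite sqrtr_ge0 -sqrtr1 ltr_sqrt.
Qed.

(** Splitting [r] as [sqrt r * sqrt r] bounds a termwise product of series at
    [r] by the product of the two series at [sqrt r]. *)
Lemma tame_mul (R : realType) (c d : nat -> nat) :
  tame R c -> tame R d -> tame R (fun n => c n * d n)%N.
Proof.
move=> tc td r r01; have s01 := sqrt_lt1 r01.
have [[K cK] [L dL]] := (tc _ s01, td _ s01).
have /andP[s0 _] := s01; have /andP[r0 _] := r01; exists (K * L) => N.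
apply: le_trans (ler_pM _ _ (cK N) (dL N)); rewrite ?partial_ge0 //.
rewrite mulr_suml; apply: ler_sum => i _.
have -> : (c i * d i)%:R * r ^+ i =
    (c i)%:R * Num.sqrt r ^+ i * ((d i)%:R * Num.sqrt r ^+ i).
  by rewrite mulrACA -natrM -exprMn -expr2 sqr_sqrtr.
rewrite ler_wpM2l ?mulr_ge0 ?exprn_ge0 // (bigD1 i) //= lerDl.
by rewrite sumr_ge0 // => j _; rewrite mulr_ge0 ?exprn_ge0.
Qed.

Lemma tame1 (R : realType) : tame R (fun=> 1%N).
Proof.
move=> r /andP[r0 r1]; exists (1 - r)^-1 => N.
under eq_bigr do rewrite mul1r.
rewrite -[leRHS]mul1r ler_pdivlMr ?subr_gt0 //.
by rewrite mulrC -opprB mulNr -subrX1 opprB lerBlDr lerDl exprn_ge0.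
Qed.

(** The sequence [n + 1] is the convolution of the constant sequence [1] with
    itself, and its powers are termwise products. *)
Lemma tame_power (R : realType) (k : nat) : tame R (fun n => n.+1 ^ k)%N.
Proof.
elim: k => [|k IH].
  by apply: (tame_le _ (@tame1 R)) => n; rewrite expn0.
apply: (@tame_le _ _ (fun n => n.+1 * n.+1 ^ k)%N) => [n|].
  by rewrite expnS.
apply: tame_mul => //.
apply: (tame_le _ (tame_convolution (@tame1 R) (@tame1 R))) => n.
by rewrite /convolution sum1_card card_ord.
Qed.

Lemma complex_sum_Re (R : realType) (F : nat -> R[i]) (m n : nat) :
  complex.Re (\sum_(m <= k < n) F k) = \sum_(m <= k < n) complex.Re (F k).
Proof. by apply: (big_morph (@complex.Re R)) => // -[a b] [c d]. Qed.

Lemma complex_sum_Im (R : realType) (F : nat -> R[i]) (m n : nat) :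
  complex.Im (\sum_(m <= k < n) F k) = \sum_(m <= k < n) complex.Im (F k).
Proof. by apply: (big_morph (@complex.Im R)) => // -[a b] [c d]. Qed.

Lemma normc_i (R : realType) : `|'i%C : R[i]| = 1.
Proof. by rewrite normc_def /= expr0n /= expr1n add0r sqrtr1. Qed.

Lemma normc_ge_Im (R : realType) (z : R[i]) : `|complex.Im z|%:C <= `|z|.
Proof.
have := normc_ge_Re (z * 'i%C).
by rewrite ReiNIm normrN normrM normc_i mulr1.
Qed.

(** Reduces complex convergence to real sequences, where completeness and
    monotone convergence apply. *)
Lemma cvg_complex (R : realType) (u : nat -> R[i]) (l : R[i]) :
  ((fun n => complex.Re (u n)) @ \oo --> complex.Re l)%classic ->
  ((fun n => complex.Im (u n)) @ \oo --> complex.Im l)%classic ->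
  ((u : nat -> R[i]^o) @ \oo --> (l : R[i]^o))%classic.
Proof.
move=> /cvgrPdist_lt ur /cvgrPdist_lt ui; apply/cvgrPdist_lt => e e0.
have [e' e'0 ->] : exists2 e' : R, 0 < e' & e = (e' + e')%:C.
  exists (complex.Re e / 2).
    by move: e0; rewrite ltcE => /andP[_ e0]; rewrite divr_gt0.
  by rewrite -splitr RRe_real // gtr0_real.
near=> n.
rewrite [X in `|X|]complexE (le_lt_trans (ler_normD _ _)) //.
rewrite rmorphD /= ltrD //.
  rewrite normc_def /= expr0n addr0 sqrtr_sqr ltcR.
  have -> : complex.Re (l - u n) = complex.Re l - complex.Re (u n).
    by case: (l) (u n) => [a b] [c d].
  by near: n; exact: ur.
rewrite normrM.
rewrite normc_i mul1r normc_def /= expr0n addr0 sqrtr_sqr ltcR.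
have -> : complex.Im (l - u n) = complex.Im l - complex.Im (u n).
  by case: (l) (u n) => [a b] [c d].
by near: n; exact: ui.
Unshelve. all: by end_near.
Qed.

Lemma qseries_term_norm (R : realType) (q : R[i]) (r : R) (k n : nat) :
  `|q| = r%:C -> `|k%:R * q ^+ n| = (k%:R * r ^+ n)%:C.
Proof.
move=> qr; rewrite normrM normrX qr normr_nat.
by rewrite rmorphM rmorphXn /= rmorph_nat.
Qed.

(** The domination is assumed from index [0] on while the sum of [u] starts at
    [1]; this is the form in which the summation range of [qseries] meets the
    bounds given by [tame]. *)
Lemma cvg_bounded_series (R : realType) (u v : nat -> R) (K : R) :
  (forall n, `|u n| <= v n) -> (forall N, \sum_(n < N) v n <= K) ->
  cvgn (fun N => \sum_(1 <= n < N) u n).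
Proof.
move=> uv vK; pose u0 n := if n is 0%N then 0 else u n.
have u0E N : \sum_(1 <= n < N) u n = series u0 N.
  rewrite /series /=; case: N => [|N]; first by rewrite !big_geq.
  rewrite [RHS]big_nat_recl // add0r big_add1 /=.
  by apply: eq_bigr.
rewrite (_ : (fun N => _) = series u0); last by apply/funext => N; rewrite u0E.
apply: normed_cvg; apply: nondecreasing_is_cvgn.
  by apply: nondecreasing_series => n _ _; rewrite normr_ge0.
exists K => _ [N _ <-]; apply: le_trans (vK N).
have -> : [normed series u0] N = \sum_(0 <= n < N) `|u0 n| by [].
rewrite big_mkord; apply: ler_sum => -[[|n] nN] _ //=.
by rewrite normr0 (le_trans _ (uv 0%N)).
Qed.

Lemma tame_is_cvg (R : realType) (c : nat -> nat) (q : R[i]) :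
  tame R c -> `|q| < 1 ->
  cvgn (fun N => \sum_(1 <= n < N) (c n)%:R * q ^+ n : R[i]^o).
Proof.
move=> tc q1; pose r := complex.Re `|q|.
have qr : `|q| = r%:C by rewrite RRe_real // normr_real.
have r01 : 0 <= r < 1.
  by rewrite -ler0c -qr normr_ge0 /= -ltcR -qr.
have [K cK] := tc r r01.
have re : cvgn (fun N => \sum_(1 <= n < N) complex.Re ((c n)%:R * q ^+ n)).
  apply: (@cvg_bounded_series _ _ (fun n => (c n)%:R * r ^+ n) K _ cK) => n.
  by rewrite -lecR (le_trans (normc_ge_Re _)) // (qseries_term_norm _ _ qr).
have im : cvgn (fun N => \sum_(1 <= n < N) complex.Im ((c n)%:R * q ^+ n)).
  apply: (@cvg_bounded_series _ _ (fun n => (c n)%:R * r ^+ n) K _ cK) => n.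
  by rewrite -lecR (le_trans (normc_ge_Im _)) // (qseries_term_norm _ _ qr).
apply/cvg_ex; exists (
  limn (fun N => \sum_(1 <= n < N) complex.Re ((c n)%:R * q ^+ n)) +i*
  limn (fun N => \sum_(1 <= n < N) complex.Im ((c n)%:R * q ^+ n)))%C.
apply: cvg_complex => /=.
  by under eq_fun do rewrite complex_sum_Re.
by under eq_fun do rewrite complex_sum_Im.
Qed.

Lemma tame_cvg (R : realType) (c : nat -> nat) (q : R[i]) :
  tame R c -> `|q| < 1 ->
  ((fun N => \sum_(1 <= n < N) (c n)%:R * q ^+ n : R[i]^o) @ \oo -->
    (qseries c q : R[i]^o))%classic.
Proof. by move=> tc q1; apply: tame_is_cvg. Qed.

(** The difference consists of the terms with [i + j >= N]. With [`|q| = s ^ 2],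
    half of the factor [s ^ (2 * (i + j))] is at most [s ^ N], and the other
    half leaves the product of the two series at [s]. *)
Lemma convolution_tail_le (R : realType) (c d : nat -> nat) (q : R[i])
    (s K L : R) (N : nat) :
  `|q| = (s ^+ 2)%:C -> 0 <= s < 1 ->
  \sum_(n < N) (c n)%:R * s ^+ n <= K ->
  \sum_(n < N) (d n)%:R * s ^+ n <= L ->
  `|(\sum_(n < N) (c n)%:R * q ^+ n) * (\sum_(n < N) (d n)%:R * q ^+ n)
    - \sum_(n < N) (convolution c d n)%:R * q ^+ n| <= (K * L * s ^+ N)%:C.
Proof.
move=> qs /andP[s0 s1] cK dL; rewrite sum_convolution big_distrlr /= -sumrB.
under eq_bigr => i _.
  rewrite (bigID (fun j : 'I_N => (i + j < N)%N)) /= addrAC subrr add0r.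
  over.
apply: (@le_trans _ _ ((\sum_(i < N) \sum_(j < N | ~~ (i + j < N)%N)
   ((c i)%:R * s ^+ i) * ((d j)%:R * s ^+ j) * s ^+ N)%:C)).
  rewrite rmorph_sum (le_trans (ler_norm_sum _ _ _)) // ler_sum // => i _.
  rewrite rmorph_sum (le_trans (ler_norm_sum _ _ _)) // ler_sum // => j ij.
  rewrite normrM !(qseries_term_norm _ _ qs) -rmorphM /= lecR.
  have -> : (c i)%:R * s ^+ 2 ^+ i * ((d j)%:R * s ^+ 2 ^+ j) =
      (c i)%:R * s ^+ i * ((d j)%:R * s ^+ j) * s ^+ (i + j).
    by rewrite -!exprM !mul2n -!addnn !exprD; ring.
  rewrite ler_wpM2l ?mulr_ge0 ?exprn_ge0 // ler_wiXn2l ?(ltW s1) //.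
  by rewrite leqNgt.
rewrite lecR; under eq_bigr do rewrite -mulr_suml.
rewrite -mulr_suml ler_wpM2r ?exprn_ge0 //.
apply: le_trans (ler_pM _ _ cK dL); rewrite ?partial_ge0 //.
rewrite big_distrlr /=; apply: ler_sum => i _; rewrite big_mkcond.
by apply: ler_sum => j _; case: ifP; rewrite // !mulr_ge0 ?exprn_ge0.
Qed.

Lemma qseries_convolution (R : realType) (c d : nat -> nat) (q : R[i]) :
  tame R c -> tame R d -> c 0%N = 0%N -> d 0%N = 0%N -> `|q| < 1 ->
  qseries c q * qseries d q = qseries (convolution c d) q.
Proof.
move=> tc td c0 d0 q1.
have from0 (b : nat -> nat) N : b 0%N = 0%N ->
    \sum_(1 <= n < N) (b n)%:R * q ^+ n = \sum_(n < N) (b n)%:R * q ^+ n.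
  move=> b0; case: N => [|N]; first by rewrite big_geq // big_ord0.
  by rewrite -[RHS](big_mkord xpredT (fun n => (b n)%:R * q ^+ n))
    [RHS]big_ltn // b0 mul0r add0r.
have cd0 : convolution c d 0 = 0%N by rewrite /convolution big_ord1 c0.
pose r := complex.Re `|q|.
have qr : `|q| = r%:C by rewrite RRe_real // normr_real.
have r01 : 0 <= r < 1 by rewrite -ler0c -qr normr_ge0 /= -ltcR -qr.
pose s := Num.sqrt r; have s01 : 0 <= s < 1 := sqrt_lt1 r01.
have qs : `|q| = (s ^+ 2)%:C by rewrite sqr_sqrtr //; case/andP: r01.
have [[K cK] [L dL]] := (tc _ s01, td _ s01).
pose part (b : nat -> nat) N : R[i]^o := \sum_(1 <= n < N) (b n)%:R * q ^+ n.
have diff0 : ((fun N => part c N * part d N - part (convolution c d) N)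
    @ \oo --> (0 : R[i]^o))%classic.
  apply/cvgrPdist_le => e e0.
  have eE : e = (complex.Re e)%:C by rewrite RRe_real // gtr0_real.
  have e'0 : 0 < complex.Re e by rewrite -ltcR -eE.
  have geo : (geometric (K * L) s @ \oo --> (0 : R))%classic.
    apply: cvg_geometric; case/andP: s01 => s0 s1.
    by rewrite ger0_norm.
  move/cvgrPdist_le: geo => /(_ _ e'0); apply: filterS => N.
  rewrite !sub0r !normrN => small.
  rewrite /part !from0 //.
  rewrite (le_trans (convolution_tail_le qs s01 (cK N) (dL N))) //.
  rewrite eE lecR; apply: le_trans small.
  by rewrite /geometric /= ler_norm.
have prod : ((fun N => part c N * part d N - part (convolution c d) N) @ \oo -->
   (qseries c q * qseries d q - qseries (convolution c d) q : R[i]^o))%classic.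
  apply: cvgB; last exact: tame_cvg (tame_convolution tc td) q1.
  by apply: cvgM; apply: tame_cvg.
apply/eqP; rewrite -subr_eq0; apply/eqP.
exact: (cvg_unique _ prod diff0).
Qed.

Lemma qseries_linear (R : realType) (I : finType) (gamma : I -> R[i])
    (d : I -> nat -> nat) (c : nat -> nat) (q : R[i]) :
  (forall i, tame R (d i)) -> `|q| < 1 ->
  (forall n, (0 < n)%N -> (c n)%:R = \sum_i gamma i * (d i n)%:R) ->
  qseries c q = \sum_i gamma i * qseries (d i) q.
Proof.
move=> td q1 cE; apply: (@cvg_lim R[i]^o) => //.
rewrite (_ : (fun N => _) = (fun N => \sum_i gamma i *
    \sum_(1 <= n < N) (d i n)%:R * q ^+ n)); last first.
  apply/funext => N; under [RHS]eq_bigr do rewrite mulr_sumr.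
  rewrite exchange_big /=; apply: eq_big_nat => n /andP[n0 _].
  by rewrite cE // mulr_suml; apply: eq_bigr => i _; rewrite mulrA.
apply: (@cvg_big R[i]^o I +%R 0 xpredT) => [|i _].
  exact: add_continuous.
by apply: cvgMr; apply: tame_cvg.
Qed.

(** * The span of the symmetrized series *)

(** There are at most [(n + 1) ^ a] tuples [s], as many tuples [m], and each
    entry of [m] is at most [n]. *)
Lemma sym_coef_le (a : nat) (v : 'I_a -> nat) (n : nat) :
  (sym_coef v n <= n.+1 ^ (a + a + \sum_(i < a) v i))%N.
Proof.
rewrite /sym_coef /bounded_sym_coef !expnD -!mulnA.
have cardE : #|{ffun 'I_a -> 'I_n.+1}| = (n.+1 ^ a)%N.
  by rewrite card_ffun !card_ord.
rewrite -{1}cardE -sum_nat_const big_mkcond; apply: leq_sum => s _.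
case: ifP => // _.
rewrite -{1}cardE -sum_nat_const big_mkcond; apply: leq_sum => m _.
case: ifP => // _.
rewrite expn_sum; apply: leq_prod => i _.
by case: (v i) => // e; rewrite leq_exp2r // ltnW.
Qed.

Lemma tame_sym_coef (R : realType) (a : nat) (v : 'I_a -> nat) :
  tame R (sym_coef v).
Proof. exact: tame_le (sym_coef_le v) (@tame_power R _). Qed.

Lemma tame_macmahonesque_coef (R : realType) (a : nat) (v : a.-tuple nat) :
  tame R (macmahonesque_coef v).
Proof.
apply: tame_le (tame_sym_coef (tnth v)) => n.
rewrite -sum_macmahonesque_coef (bigD1 1%g) //=.
apply: leq_trans (leq_addr _ _).
suff -> : [tuple tnth v ((1%g : 'S_a) i) | i < a] = v by [].
by apply: eq_from_tnth => i; rewrite tnth_mktuple perm1.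
Qed.

Lemma macmahonesque_symE (R : realType) (a : nat) (v : a.-tuple nat)
    (q : R[i]) : `|q| < 1 ->
  macmahonesque_sym v q = qseries (sym_coef (tnth v)) q.
Proof.
move=> q1; rewrite (@qseries_linear R 'S_a (fun=> 1)
  (fun sigma => macmahonesque_coef [tuple tnth v (sigma i) | i < a])) //.
- by apply: eq_bigr => sigma _; rewrite mul1r.
- by move=> sigma; apply: tame_macmahonesque_coef.
move=> n _; rewrite -sum_macmahonesque_coef natr_sum.
by apply: eq_bigr => sigma _; rewrite mul1r.
Qed.

Lemma nome_lt1 (R : realType) (tau : upper_half_plane R) : `|nome tau| < 1.
Proof.
case: tau => -[x y] /= y0; rewrite /nome /expC /= normrM.
rewrite [X in _ * X]normc_def /= cos2Dsin2 sqrtr1 mulr1.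
rewrite normc_def /= expr0n addr0 sqrtr_sqr ger0_norm ?expR_ge0 //.
rewrite -[X in _ < X](rmorph1 (real_complex R)) ltcR expR_lt1.
rewrite !(mul0r, mulr0, mulr1, subr0, sub0r, add0r, addr0).
rewrite oppr0 mul0r sub0r oppr_lt0; apply: mulr_gt0 => //.
by apply: mulr_gt0; [rewrite addr_gt0 | exact: pi_gt0].
Qed.

(** The linear span of the constants and of the symmetrized series. Presenting
    it by closure rules makes multiplication by [G_k] an induction on the
    rules. *)
Inductive mac_span (R : realType) : (upper_half_plane R -> R[i]) -> Prop :=
| MacConst c : mac_span (fun=> c)
| MacSym (a : nat) (v : a.-tuple nat) : (0 < a)%N ->
    (forall i, odd (tnth v i)) ->
    mac_span (fun tau => macmahonesque_sym v (nome tau))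
| MacAdd f g : mac_span f -> mac_span g -> mac_span (fun tau => f tau + g tau)
| MacScale c f : mac_span f -> mac_span (fun tau => c * f tau).

Lemma eq_mac_span (R : realType) (f g : upper_half_plane R -> R[i]) :
  (forall tau, f tau = g tau) -> mac_span f -> mac_span g.
Proof. by move=> /funext ->. Qed.

Lemma mac_span_sum (R : realType) (I : Type) (r : seq I)
    (f : I -> upper_half_plane R -> R[i]) :
  (forall i, mac_span (f i)) -> mac_span (fun tau => \sum_(i <- r) f i tau).
Proof.
move=> fs; elim: r => [|i r IH].
  by apply: (eq_mac_span _ (MacConst 0)) => tau; rewrite big_nil.
by apply: (eq_mac_span _ (MacAdd (fs i) IH)) => tau; rewrite big_cons.
Qed.

Lemma mac_span_sym_coef (R : realType) (a : nat) (v : 'I_a -> nat) :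
  (0 < a)%N ->
  (forall i, odd (v i)) ->
  @mac_span R (fun tau => qseries (sym_coef v) (nome tau)).
Proof.
move=> a0 vo; pose t := [tuple v i | i < a].
apply: (eq_mac_span _ (@MacSym R a t a0 _)) => [tau|i]; last first.
  by rewrite tnth_mktuple.
rewrite macmahonesque_symE ?nome_lt1 //; congr (qseries (sym_coef _) _).
by apply/funext => i; rewrite tnth_mktuple.
Qed.

(** Both series are taken over [n >= 1], the range in which the divisor sum is
    the coefficient of the series of length one. *)
Lemma eisensteinE (R : realType) (k : nat) (tau : upper_half_plane R) :
  (0 < k)%N ->
  eisenstein k.+1 tau = - (ratr (bernoulli_number k.+1) / (2 * k.+1)%:R)
    + qseries (sym_coef (fun _ : 'I_1 => k)) (nome tau).
Proof.
move=> k0; rewrite /eisenstein; congr (_ + _).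
rewrite (@qseries_linear R 'I_1 (fun=> 1)
  (fun=> sym_coef (fun _ : 'I_1 => k))) ?nome_lt1 //.
- by rewrite big_ord1 mul1r.
- by move=> _; apply: tame_sym_coef.
by move=> n n0; rewrite big_ord1 mul1r sym_coef1.
Qed.

Lemma sym_coef_at0 (a : nat) (v : 'I_a -> nat) : (0 < a)%N ->
  sym_coef v 0 = 0%N.
Proof.
case: a v => // a v _; apply: big1 => s /andP[/forallP/(_ ord0)].
by rewrite (ord1 (s ord0)).
Qed.

(** The values of [sym_coef_mul]: the summand [unit] of the index type carries
    the extended vector, and the other summand the replacements of one entry. *)
Lemma mac_span_mul_sigma (R : realType) (k a : nat) (v : 'I_a -> nat) :
  odd k -> (0 < a)%N -> (forall i, odd (v i)) ->
  @mac_span R (fun tau => qseries (sym_coef (fun _ : 'I_1 => k)) (nome tau)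
    * qseries (sym_coef v) (nome tau)).
Proof.
move=> ko a0 vo; have [d [c cE]] := sym_coef_mul R[i] ko vo.
pose I := (unit + {i : 'I_a & 'I_(d i)})%type.
pose gamma (x : I) : R[i] :=
  if x is inr p then c (tag p) (tagged p) else 1.
pose g (x : I) : nat -> nat :=
  if x is inr p then sym_coef (replace_at (tag p) (tagged p).*2.+1 v)
  else sym_coef (fcons k v).
apply: (@eq_mac_span _
    (fun tau => \sum_(x : I) gamma x * qseries (g x) (nome tau))); last first.
  apply: mac_span_sum => -[u|[i j]]; apply: MacScale;
    apply: mac_span_sym_coef => //.
    by move=> i; rewrite /fcons; case: unlift.
  by move=> l; rewrite /replace_at; case: ifP => //= _; rewrite odd_double.
move=> tau; rewrite qseries_convolution ?nome_lt1 ?sym_coef_at0 //;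
  try exact: tame_sym_coef.
apply/esym/qseries_linear => [x||n _]; rewrite ?nome_lt1 //.
  by case: x => [?|?]; apply: tame_sym_coef.
rewrite /convolution natr_sum big_sumType /=.
under eq_bigr do rewrite natrM.
rewrite cE big_const card_unit /= addr0 mul1r; congr (_ + _).
by rewrite sig_big_dep.
Qed.

Lemma mac_span_mul_eisenstein (R : realType) (k : nat)
    (f : upper_half_plane R -> R[i]) : odd k -> mac_span f ->
  mac_span (fun tau => eisenstein k.+1 tau * f tau).
Proof.
move=> ko; have k0 := odd_gt0 ko.
have es : mac_span (@eisenstein R k.+1).
  apply: (eq_mac_span _ (MacAdd (MacConst _)
    (@mac_span_sym_coef R 1 (fun=> k) isT (fun=> ko)))) => tau.
  by rewrite eisensteinE.
elim=> {f} [c|a v a0 vo|f g _ IHf _ IHg|c f _ IH].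
- by apply: (eq_mac_span _ (MacScale c es)) => tau; rewrite mulrC.
- apply: (eq_mac_span _ (MacAdd (MacScale
      (- (ratr (bernoulli_number k.+1) / (2 * k.+1)%:R)) (MacSym R a0 vo))
    (mac_span_mul_sigma R ko a0 vo))) => tau.
  by rewrite eisensteinE // mulrDl macmahonesque_symE ?nome_lt1.
- by apply: (eq_mac_span _ (MacAdd IHf IHg)) => tau; rewrite mulrDr.
- by apply: (eq_mac_span _ (MacScale c IH)) => tau; rewrite mulrCA.
Qed.

Lemma quasimodular_mac_span (R : realType) (f : upper_half_plane R -> R[i]) :
  quasimodular f -> mac_span f.
Proof.
case=> P fE; pose G (tau : upper_half_plane R) :=
  [tuple eisenstein 2 tau; eisenstein 4 tau; eisenstein 6 tau].
have GX (i : 'I_3) (n : nat) (g : upper_half_plane R -> R[i]) : mac_span g ->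
    mac_span (fun tau : upper_half_plane R => tnth (G tau) i ^+ n * g tau).
  move=> gs; elim: n => [|n IH].
    by apply: (eq_mac_span _ gs) => tau; rewrite expr0 mul1r.
  have [k ko kE] : exists2 k, odd k &
      forall tau : upper_half_plane R, tnth (G tau) i = eisenstein k.+1 tau.
    case: i {IH} => -[|[|[|//]]] i3;
      [exists 1%N | exists 3%N | exists 5%N] => // tau;
      by rewrite (tnth_nth 0).
  apply: (eq_mac_span _ (mac_span_mul_eisenstein ko IH)) => tau.
  by rewrite exprS -mulrA -kE.
apply: (@eq_mac_span _ (fun tau => \sum_(m <- mpoly.msupp P) mpoly.mcoeff m P *
    \prod_i tnth (G tau) i ^+ mpoly.fun_of_multinom m i)) => [tau|].
  by rewrite fE mpoly.mevalE.
apply: mac_span_sum => m; apply: MacScale.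
elim: (index_enum _) => [|i s IH].
  by apply: (eq_mac_span _ (MacConst 1)) => tau; rewrite big_nil.
by apply: (eq_mac_span _ (GX i _ _ IH)) => tau; rewrite big_cons.
Qed.

Definition odd_vector (v : {a : nat & a.-tuple nat}) : bool :=
  (0 < tag v)%N && all odd (tagged v : (tag v).-tuple nat).

Lemma mac_span_seq (R : realType) (f : upper_half_plane R -> R[i]) :
  mac_span f -> exists (c0 : R[i]) (l : seq (R[i] * {a : nat & a.-tuple nat})),
    all (fun x => odd_vector x.2) l /\
    forall tau, f tau =
      c0 + \sum_(x <- l) x.1 * macmahonesque_sym (tagged x.2) (nome tau).
Proof.
elim=> {f} [c|a v a0 vo|f g _ [c0 [l [lo fE]]] _ [d0 [m [mo gE]]]|
  c f _ [c0 [l [lo fE]]]].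
- by exists c, [::]; split=> // tau; rewrite big_nil addr0.
- exists 0, [:: (1, existT _ a v)]; split=> [|tau]; last first.
    by rewrite big_seq1 mul1r add0r.
  by rewrite /= /odd_vector a0 andbT; apply/all_tnthP.
- exists (c0 + d0), (l ++ m); split=> [|tau]; first by rewrite all_cat lo.
  by rewrite fE gE big_cat addrACA.
exists (c * c0), [seq (c * x.1, x.2) | x <- l]; split=> [|tau].
  by rewrite all_map.
rewrite fE big_map mulrDr mulr_sumr; congr (_ + _).
by apply: eq_bigr => x _; rewrite mulrA.
Qed.

Theorem theorem1p5 (R : realType) (f : upper_half_plane R -> R[i])
    (hf : quasimodular f) :
  exists (c0 : R[i]) (N : nat) (c : 'I_N -> R[i]) (a : 'I_N -> nat)
         (v : forall j : 'I_N, (a j).-tuple nat),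
    (forall j : 'I_N, (0 < a j)%N) /\
    (forall (j : 'I_N) (i : 'I_(a j)), odd (tnth (v j) i)) /\
    (forall tau : upper_half_plane R,
       f tau = c0 + \sum_(j < N) c j * macmahonesque_sym (v j) (nome tau)).
Proof.
have [c0 [l [lo fE]]] := mac_span_seq (quasimodular_mac_span hf).
pose t j := tnth (in_tuple l) j.
exists c0, (size l), (fun j => (t j).1), (fun j => tag (t j).2),
  (fun j => tagged (t j).2).
have /all_tnthP ht : all (fun x => odd_vector x.2)
  (in_tuple l) by [].
split=> [j|]; first by case/andP: (ht j).
split=> [j i|tau]; last by rewrite fE big_tnth.
by case/andP: (ht j) => _ /all_tnthP.
Qed.
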